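(* Let $m$ be a nonnegative integer and let $\alpha,c_1,\dots,c_m$ be complex numbers. Then $$(\alpha q;q)_\infty\prod_{j=1}^m(\alpha c_j;q)_\infty=\sum_{n=0}^\infty\frac{(1-\alpha q^{2n})(\alpha;q)_n(-1)^nq^{n(n-1)/2}}{(1-\alpha)(q;q)_n}\;{}_{m+2}\phi_{m+1}\left({q^{-n},\alpha q^n,\alpha c_1,\dots,\alpha c_m\atop 0,0,\dots,0};q,q\right),$$ where the ${}_{m+2}\phi_{m+1}$ has $m+1$ lower parameters, all equal to $0$.
   Context: Throughout $0<q<1$. Put $(x;q)_0=1$, $(x;q)_n=\prod_{k=0}^{n-1}(1-xq^k)$, $(x;q)_\infty=\prod_{k\ge0}(1-xq^k)$, and $(x_1,\dots,x_r;q)_n=(x_1;q)_n\cdots(x_r;q)_n$. The basic hypergeometric series is $${}_{r+1}\phi_r\left({a_1,\dots,a_{r+1}\atop b_1,\dots,b_r};q,z\right)=\sum_{k=0}^\infty\frac{(a_1,\dots,a_{r+1};q)_k}{(q,b_1,\dots,b_r;q)_k}z^k ;$$ when some $a_i=q^{-n}$ with $n\ge 0$ an integer, it is the finite sum over $0\le k\le n$. The factor $(1-\alpha q^{2n})(\alpha;q)_n/(1-\alpha)$ means $1$ for $n=0$ and $(1-\alpha q^{2n})(\alpha q;q)_{n-1}$ for $n\ge1$, also for $\alpha=1$. *)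

(* Defs.v *)
From Stdlib Require Import Reals Lra Lia List Arith.
From Coquelicot Require Import Coquelicot.
Import ListNotations.

Open Scope C_scope.

(* Limit of a complex sequence; meaningful when the sequence converges, see
   [Clim_seq_unique]. *)
Definition Clim_seq (u : nat -> C) : C :=
  iota (T := C_CompleteNormedModule)
    (fun l => filterlim u eventually (locally l)).

Definition Cprod (l : list C) : C := fold_right Cmult 1 l.

Fixpoint qpoch (x q : C) (n : nat) : C :=
  match n with
  | O => 1
  | S k => qpoch x q k * (1 - x * q ^ k)
  end.

Definition qpochs (xs : list C) (q : C) (n : nat) : C :=
  Cprod (map (fun x => qpoch x q n) xs).

Definition qpoch_inf (x q : C) : C := Clim_seq (qpoch x q).

Definition phi_term (a b : list C) (q z : C) (k : nat) : C :=
  qpochs a q k / qpochs (q :: b) q k * z ^ k.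

(* The series with r+1 upper and r lower parameters corresponds to
   [length a = r + 1], [length b = r]; the formula itself makes sense for all
   lists.  In the terminating case this is the finite sum, see
   [phi_terminating]. *)
Definition phi (a b : list C) (q z : C) : C :=
  Clim_seq (sum_n (phi_term a b q z)).

(* (1 - alpha q^(2n)) (alpha;q)_n / (1 - alpha), with the removable singularity
   at alpha = 1 filled in; see [vwp_generic]. *)
Definition vwp (alpha q : C) (n : nat) : C :=
  match n with
  | O => 1
  | S k => (1 - alpha * q ^ (2 * n)) * qpoch (alpha * q) q k
  end.

Lemma Clim_seq_unique (u : nat -> C) (l : C) :
  filterlim u eventually (locally l) -> Clim_seq u = l.
Proof.
intros H.
exact (iota_filterlim_locally (K := C_AbsRing) (V := C_CompleteNormedModule) u l H).
Qed.

Lemma qpoch_shift (x q : C) (n : nat) :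
  qpoch x q (S n) = (1 - x) * qpoch (x * q) q n.
Proof.
induction n as [|n IH].
- simpl; ring.
- change (qpoch x q (S (S n))) with (qpoch x q (S n) * (1 - x * q ^ S n)).
  rewrite IH; simpl; ring.
Qed.

Lemma vwp_generic (alpha q : C) (n : nat) : alpha <> 1 ->
  vwp alpha q n = (1 - alpha * q ^ (2 * n)) * qpoch alpha q n / (1 - alpha).
Proof.
intros H.
assert (H1 : 1 - alpha <> 0).
{ intros E; apply H.
  transitivity (1 - (1 - alpha)); [ring | rewrite E; ring]. }
destruct n as [|n].
- simpl; field; exact H1.
- rewrite qpoch_shift; unfold vwp; field; exact H1.
Qed.

Lemma qpoch_qinv_eq0 (q : C) (n k : nat) : q <> 0 -> (n < k)%nat ->
  qpoch (/ q ^ n) q k = 0.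
Proof.
intros Hq; induction k as [|k IH]; intros Hk; [lia|].
simpl; destruct (Nat.eq_dec n k) as [E|E].
- subst k; rewrite Cinv_l; [ring | exact (Cpow_nz q n Hq)].
- rewrite IH by lia; ring.
Qed.

Lemma phi_terminating (a b : list C) (q z : C) (n : nat) :
  q <> 0 -> In (/ q ^ n) a ->
  phi a b q z = sum_n (phi_term a b q z) n.
Proof.
intros Hq Ha.
assert (H0 : forall k, (n < k)%nat -> phi_term a b q z k = 0).
{ intros k Hk; unfold phi_term.
  replace (qpochs a q k) with (RtoC 0); [unfold Cdiv; ring|].
  clear - Hq Ha Hk; unfold qpochs.
  induction a as [|x a IH]; [destruct Ha|].
  destruct Ha as [E|Ha]; simpl.
  - subst x; rewrite qpoch_qinv_eq0 by assumption; ring.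
  - rewrite <- IH by assumption; ring. }
apply Clim_seq_unique.
apply filterlim_ext_loc with (fun _ => sum_n (phi_term a b q z) n).
- exists n; intros p Hp; induction Hp as [|p Hp IH]; [reflexivity|].
  rewrite sum_Sn, <- IH, H0 by lia.
  symmetry; apply (plus_zero_r (G := C_AbelianGroup)).
- apply filterlim_const.
Qed.

(* Main.v *)
Require Import Defs.
From Stdlib Require Import Reals List Lra Lia.
From Coquelicot Require Import Coquelicot.
Import ListNotations.
Open Scope C_scope.

(** Write [A k] for the product of the [(alpha c_j; q)_k] and [B n] for
    [(alpha q; q)_n].  The double sum over [n <= N] and [k <= n] is arranged by
    [k]: for fixed [k] the coefficients of [A k] telescope in [n]
    ([bailey_coeff_diag], [bailey_coeff_step]), which is the mechanism behind
    Bailey pairs, and the [N]-th partial sum of the series becomes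

      [S N = sum_{k <= N} w N k * A k * B (N + k)],
      [w N k = (-1)^(N-k) q^((N-k)(N-k+1)/2) / ((q;q)_k (q;q)_(N-k))]

    ([partial_sum_bailey]).  The weights [w N k] add up to [1] for every [N]
    ([sum_euler_weights], a case of the finite q-binomial theorem), and because
    of the quadratic power of [q] they concentrate near [k = N].  So [S N] is a
    weighted mean of products [A k * B (N + k)] with large [k], and it tends to
    the limit of these products, which is the left-hand side of the identity.

    The passage to the limit is quantitative.  Each finite q-Pochhammer symbol
    converges to the infinite one at rate [O(q^n)] ([geom_cvg_qpoch]), rates
    survive products, and [w N k = O(q^(2(N-k)))]; hence
    [S N - lim A * lim B] is [O(sum_{k <= N} q^(2(N-k)) q^k) = O(q^N)]
    ([geom_cvg_weighted_sum]). *)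

(** * Arithmetic and finite sums over [C] *)

(* Equations between sums live in the carrier of an algebraic structure;
   [ring] has to see the type [C] itself. *)
Ltac Ceq := match goal with |- ?a = ?b => change (@eq C a b) end.

Lemma Csum_O (f : nat -> C) : sum_n f 0 = f 0%nat.
Proof. exact (sum_O f). Qed.

Lemma Csum_S (f : nat -> C) (n : nat) : sum_n f (S n) = sum_n f n + f (S n).
Proof. exact (sum_Sn f n). Qed.

Lemma Csum_head (f : nat -> C) (n : nat) :
  sum_n f (S n) = f 0%nat + sum_n (fun k => f (S k)) n.
Proof.
induction n as [|n IH].
- now rewrite Csum_S, !Csum_O.
- rewrite Csum_S, IH, Csum_S; Ceq; ring.
Qed.

Lemma Csum_plus (f g : nat -> C) (n : nat) :
  sum_n (fun k => f k + g k) n = sum_n f n + sum_n g n.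
Proof. exact (sum_n_plus f g n). Qed.

Lemma Csum_scal (a : C) (f : nat -> C) (n : nat) :
  sum_n (fun k => a * f k) n = a * sum_n f n.
Proof. exact (sum_n_mult_l (K := C_Ring) a f n). Qed.

Lemma Csum_Cmod_le (f : nat -> C) (g : nat -> R) (n : nat) :
  (forall k, (k <= n)%nat -> (Cmod (f k) <= g k)%R) ->
  (Cmod (sum_n f n) <= sum_n g n)%R.
Proof.
induction n as [|n IH]; intros H.
- rewrite Csum_O, sum_O; apply H; lia.
- rewrite Csum_S, sum_Sn.
  apply Rle_trans with (1 := Cmod_triangle _ _).
  apply Rplus_le_compat; [apply IH; intros k Hk|]; apply H; lia.
Qed.

Lemma Cmult_cancel_l (a b c : C) : a <> 0 -> a * b = a * c -> b = c.
Proof.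
intros Ha E.
transitivity (/ a * (a * b)); [field; exact Ha|].
rewrite E; field; exact Ha.
Qed.

(** * Telescoping the coefficients *)

Lemma half_SnSn (n : nat) :
  (S n * (S n - 1) / 2 = n * (n - 1) / 2 + n)%nat.
Proof.
destruct n as [|n]; [reflexivity|].
rewrite <- Nat.div_add by lia; f_equal; simpl; nia.
Qed.

Lemma qpoch_add (x q : C) (m n : nat) :
  qpoch x q (m + n) = qpoch x q m * qpoch (x * q ^ m) q n.
Proof.
induction n as [|n IH].
- rewrite Nat.add_0_r; simpl; ring.
- rewrite Nat.add_succ_r; simpl; rewrite IH, Cpow_add_r; ring.
Qed.

Lemma qpoch_qq_neq0 (q : C) (n : nat) :
  (forall k, 1 - q * q ^ k <> 0) -> qpoch q q n <> 0.
Proof.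
intros Hq; induction n as [|n IH]; simpl.
- exact C1_nz.
- now apply Cmult_neq_0.
Qed.

(** The coefficients [(-1)^i q^(i(i+1)/2) / (q;q)_i] of Euler's expansion of
    [(q z; q)_oo] in powers of [z].  The exponent is split as
    [i(i-1)/2 + i] so that [half_SnSn] handles both it and the exponent in the
    theorem. *)
Definition euler_coeff (q : C) (i : nat) : C :=
  (- (1)) ^ i * q ^ (i * (i - 1) / 2) * q ^ i / qpoch q q i.

Lemma euler_coeff_S (q : C) (i : nat) :
  (forall k, 1 - q * q ^ k <> 0) ->
  euler_coeff q (S i) * (1 - q * q ^ i) = - (q * q ^ i) * euler_coeff q i.
Proof.
intros Hq; unfold euler_coeff; rewrite half_SnSn, Cpow_add_r.
pose proof (qpoch_qq_neq0 q i Hq); pose proof (Hq i).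
simpl; field; split; assumption.
Qed.

(** Multiplying the sum for [N + 1] by
    [1 - q^(N+1) = (1 - q^k) + q^k (1 - q^(N+1-k))] lowers [k] in the first part
    and [N + 1 - k] in the second, and gives [(1 - q^(N+1))] times the sum for
    [N]; so the sum does not depend on [N]. *)
Lemma sum_euler_weights (q : C) (N : nat) :
  (forall k, 1 - q * q ^ k <> 0) ->
  sum_n (fun k => / qpoch q q k * euler_coeff q (N - k)) N = RtoC 1.
Proof.
intros Hq; induction N as [|N IH].
- rewrite Csum_O; unfold euler_coeff; simpl; Ceq; field; exact C1_nz.
- assert (E : (1 - q * q ^ N)
      * sum_n (fun k => / qpoch q q k * euler_coeff q (S N - k)) (S N)
      = (1 - q * q ^ N) * 1).
  { rewrite <- Csum_scal.
    rewrite (sum_n_ext_loc _ (fun k =>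
        (1 - q ^ k) * / qpoch q q k * euler_coeff q (S N - k)
        + / qpoch q q k * (q ^ k * (1 - q ^ (S N - k)) * euler_coeff q (S N - k)))).
    2:{ intros k Hk.
        replace (q * q ^ N) with (q ^ k * q ^ (S N - k)); [Ceq; ring|].
        rewrite <- Cpow_add_r, <- Cpow_S; f_equal; lia. }
    rewrite Csum_plus, Csum_head, Csum_S.
    rewrite (sum_n_ext_loc (fun k => (1 - q ^ S k) * _ * _)
               (fun k => / qpoch q q k * euler_coeff q (N - k))).
    2:{ intros k Hk; pose proof (qpoch_qq_neq0 q k Hq); pose proof (Hq k).
        simpl (S N - S k)%nat; simpl; Ceq; field; split; assumption. }
    rewrite (sum_n_ext_loc (fun k => / qpoch q q k * (q ^ k * _ * _))
               (fun k => - (q * q ^ N) * (/ qpoch q q k * euler_coeff q (N - k)))).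
    2:{ intros k Hk; rewrite Nat.sub_succ_l by lia.
        replace (q ^ N) with (q ^ k * q ^ (N - k))
          by (rewrite <- Cpow_add_r; f_equal; lia).
        transitivity (/ qpoch q q k * q ^ k
          * (euler_coeff q (S (N - k)) * (1 - q * q ^ (N - k)))).
        - rewrite Cpow_S; Ceq; ring.
        - rewrite euler_coeff_S by exact Hq; Ceq; ring. }
    rewrite Csum_scal, IH, Nat.sub_diag; simpl; Ceq; ring. }
  exact (Cmult_cancel_l _ _ _ (Hq N) E).
Qed.

(** The reversal [(q^-n; q)_k = (-1)^k q^(k(k-1)/2 - n k) (q;q)_n / (q;q)_(n-k)]
    with [n = k + i], cleared of denominators and of negative powers of [q]. *)
Lemma qpoch_qinv (q : C) (k i : nat) : q <> 0 ->
  qpoch (/ q ^ (k + i)) q k * q ^ k * q ^ ((k + i) * (k + i - 1) / 2)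
    * qpoch q q i
  = (- (1)) ^ k * q ^ (i * (i - 1) / 2) * qpoch q q (k + i).
Proof.
intros Hq; induction k as [|k IH].
- simpl; ring.
- change (S k + i)%nat with (S (k + i)).
  rewrite qpoch_shift, half_SnSn, Cpow_add_r.
  replace (/ q ^ S (k + i) * q) with (/ q ^ (k + i)).
  2:{ pose proof (Cpow_nz q (k + i) Hq); simpl; field; split; assumption. }
  transitivity ((q ^ S (k + i) - 1) * (qpoch (/ q ^ (k + i)) q k * q ^ k
      * q ^ ((k + i) * (k + i - 1) / 2) * qpoch q q i)).
  + pose proof (Cpow_nz q (k + i) Hq); simpl; field; split; assumption.
  + rewrite IH; simpl; ring.
Qed.

(** The very-well-poised factor contributes [(alpha q; q)_p], which the
    upper parameter [alpha q^(p+1)] prolongs without a gap. *)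
Lemma vwp_mult_qpoch (alpha q : C) (p k : nat) :
  vwp alpha q (S p) * qpoch (alpha * q ^ S p) q k
  = (1 - alpha * q ^ (2 * S p)) * qpoch (alpha * q) q (p + k).
Proof.
unfold vwp; rewrite qpoch_add.
replace (alpha * q * q ^ p) with (alpha * q ^ S p) by (simpl; ring).
ring.
Qed.

(** The coefficient with which [A k] occurs in the [n]-th term of the series. *)
Definition bailey_coeff (alpha q : C) (n k : nat) : C :=
  vwp alpha q n * (- (1)) ^ n * q ^ (n * (n - 1) / 2) / qpoch q q n
  * (qpoch (/ q ^ n) q k * qpoch (alpha * q ^ n) q k / qpoch q q k * q ^ k).

(** The closed form of [sum_{k <= j <= n} bailey_coeff alpha q j k]. *)
Definition partial_coeff (alpha q : C) (n k : nat) : C :=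
  / qpoch q q k * euler_coeff q (n - k) * qpoch (alpha * q) q (n + k).

Lemma m1_pow_sqr (k : nat) : (- (1)) ^ k * (- (1)) ^ k = 1.
Proof.
induction k as [|k IH]; simpl; [ring|].
transitivity ((- (1)) ^ k * (- (1)) ^ k); [ring | exact IH].
Qed.

Lemma bailey_coeff_E (alpha q : C) (k i : nat) :
  q <> 0 -> (forall k, 1 - q * q ^ k <> 0) ->
  bailey_coeff alpha q (k + i) k
  = / qpoch q q k * ((- (1)) ^ i * q ^ (i * (i - 1) / 2) / qpoch q q i)
    * (vwp alpha q (k + i) * qpoch (alpha * q ^ (k + i)) q k).
Proof.
intros Hq0 Hq; unfold bailey_coeff.
pose proof (qpoch_qq_neq0 q k Hq).
pose proof (qpoch_qq_neq0 q i Hq).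
pose proof (qpoch_qq_neq0 q (k + i) Hq).
transitivity (vwp alpha q (k + i) * qpoch (alpha * q ^ (k + i)) q k
  * (- (1)) ^ (k + i) / qpoch q q (k + i) / qpoch q q k / qpoch q q i
  * (qpoch (/ q ^ (k + i)) q k * q ^ k * q ^ ((k + i) * (k + i - 1) / 2)
    * qpoch q q i)).
- field; auto.
- rewrite qpoch_qinv by exact Hq0.
  rewrite (Cpow_add_r (- (1)) k i).
  transitivity (((- (1)) ^ k * (- (1)) ^ k)
    * (/ qpoch q q k * ((- (1)) ^ i * q ^ (i * (i - 1) / 2) / qpoch q q i)
    * (vwp alpha q (k + i) * qpoch (alpha * q ^ (k + i)) q k))).
  + field; auto.
  + rewrite m1_pow_sqr; ring.
Qed.

Lemma bailey_coeff_diag (alpha q : C) (k : nat) :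
  q <> 0 -> (forall k, 1 - q * q ^ k <> 0) ->
  bailey_coeff alpha q k k = partial_coeff alpha q k k.
Proof.
intros Hq0 Hq.
pose proof (bailey_coeff_E alpha q k 0 Hq0 Hq) as E.
rewrite Nat.add_0_r in E; rewrite E; clear E.
unfold partial_coeff; rewrite Nat.sub_diag; unfold euler_coeff.
destruct k as [|p].
- simpl; field; exact C1_nz.
- rewrite vwp_mult_qpoch.
  change (S p + S p)%nat with (S (p + S p)).
  replace (2 * S p)%nat with (S (p + S p)) by lia.
  pose proof (qpoch_qq_neq0 q p Hq); pose proof (Hq p).
  simpl; field; auto using C1_nz.
Qed.

(** With [i = n - k] this is, up to common factors, the identity
    [(1 - alpha q^(2k+2i+2))
     = (1 - q^(i+1)) + q^(i+1) (1 - alpha q^(2k+i+1))]. *)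
Lemma bailey_coeff_step (alpha q : C) (n k : nat) : (k <= n)%nat ->
  q <> 0 -> (forall k, 1 - q * q ^ k <> 0) ->
  bailey_coeff alpha q (S n) k
  = partial_coeff alpha q (S n) k - partial_coeff alpha q n k.
Proof.
intros Hk Hq0 Hq.
replace n with (k + (n - k))%nat by lia; generalize (n - k)%nat; clear n Hk.
intros i; rewrite <- Nat.add_succ_r, bailey_coeff_E by assumption.
unfold partial_coeff.
replace (k + S i - k)%nat with (S i) by lia.
replace (k + i - k)%nat with i by lia.
replace (k + S i)%nat with (S (k + i)) by lia.
rewrite vwp_mult_qpoch.
replace (2 * S (k + i))%nat with (S (k + i + k) + S i)%nat by lia.
change (S (k + i) + k)%nat with (S (k + i + k)).
simpl (qpoch _ _ (S (k + i + k))).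
pose proof (qpoch_qq_neq0 q k Hq).
pose proof (qpoch_qq_neq0 q i Hq); pose proof (Hq i).
unfold euler_coeff; rewrite half_SnSn, !Cpow_add_r, !Cpow_S, !Cpow_add_r; simpl (qpoch q q (S i)).
field; auto.
Qed.

Lemma partial_sum_bailey (alpha q : C) (A : nat -> C) (N : nat) :
  q <> 0 -> (forall k, 1 - q * q ^ k <> 0) ->
  sum_n (fun n => sum_n (fun k => bailey_coeff alpha q n k * A k) n) N
  = sum_n (fun k => partial_coeff alpha q N k * A k) N.
Proof.
intros Hq0 Hq; induction N as [|N IH].
- rewrite !Csum_O, bailey_coeff_diag by assumption; reflexivity.
- rewrite Csum_S, IH, 2!Csum_S, bailey_coeff_diag, Cplus_assoc, <- Csum_plus
    by assumption.
  f_equal; apply sum_n_ext_loc; intros k Hk.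
  rewrite bailey_coeff_step by assumption; Ceq; ring.
Qed.

(** * Geometric convergence *)

(** Explicit rates replace limits: they make the sum over [k] of the errors a
    geometric one. *)
Definition geom_cvg (r : R) (u : nat -> C) (l : C) : Prop :=
  exists B : R, forall n, (Cmod (u n - l) <= B * r ^ n)%R.

Lemma geom_cvg_filterlim (r : R) (u : nat -> C) (l : C) :
  (0 < r < 1)%R -> geom_cvg r u l -> filterlim u eventually (locally l).
Proof.
intros Hr [B HB].
apply (filterlim_locally_ball_norm (K := C_AbsRing) (U := C_NormedModule)).
intros eps.
assert (HL : is_lim_seq (fun n => B * r ^ n)%R 0).
{ replace (Finite 0) with (Rbar_mult B 0) by (simpl; f_equal; ring).
  apply is_lim_seq_scal_l, is_lim_seq_geom.
  rewrite Rabs_pos_eq; lra. }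
apply is_lim_seq_spec in HL; destruct (HL eps) as [N HN].
exists N; intros n Hn.
apply Rle_lt_trans with (1 := HB n).
apply Rle_lt_trans with (2 := HN n Hn).
rewrite Rminus_0_r; apply Rle_abs.
Qed.

Lemma geom_cvg_bounded (r : R) (u : nat -> C) (l : C) :
  (0 < r < 1)%R -> geom_cvg r u l -> exists M : R, forall n, (Cmod (u n) <= M)%R.
Proof.
intros Hr [B HB]; exists (B + Cmod l)%R; intros n.
replace (u n) with ((u n - l) + l) by ring.
apply Rle_trans with (1 := Cmod_triangle _ _).
apply Rplus_le_compat_r, Rle_trans with (1 := HB n).
assert (0 <= B)%R.
{ generalize (HB O); simpl; pose proof (Cmod_ge_0 (u O - l)); lra. }
assert (r ^ n <= 1)%R.
{ rewrite <- (pow1 n); apply pow_incr; lra. }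
nra.
Qed.

Lemma geom_cvg_mult (r : R) (u v : nat -> C) (l m : C) :
  (0 < r < 1)%R -> geom_cvg r u l -> geom_cvg r v m ->
  geom_cvg r (fun n => u n * v n) (l * m).
Proof.
intros Hr Hu [B HB].
destruct (geom_cvg_bounded r u l Hr Hu) as [M HM]; destruct Hu as [A HA].
exists (M * B + A * Cmod m)%R; intros n.
replace (u n * v n - l * m) with (u n * (v n - m) + (u n - l) * m) by ring.
apply Rle_trans with (1 := Cmod_triangle _ _); rewrite !Cmod_mult.
pose proof (HA n); pose proof (HB n); pose proof (HM n).
pose proof (Cmod_ge_0 (u n)); pose proof (Cmod_ge_0 (v n - m)).
pose proof (Cmod_ge_0 m).
assert (Cmod (u n) * Cmod (v n - m) <= M * (B * r ^ n))%R
  by (apply Rmult_le_compat; assumption).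
assert (Cmod (u n - l) * Cmod m <= A * r ^ n * Cmod m)%R
  by (apply Rmult_le_compat_r; assumption).
lra.
Qed.

(** The limit exists by completeness, as the sum of the increments; summing the
    tail of the geometric bound gives the rate. *)
Lemma geom_cvg_of_steps (r B : R) (u : nat -> C) :
  (0 < r < 1)%R -> (forall n, (Cmod (u (S n) - u n) <= B * r ^ n)%R) ->
  exists l, geom_cvg r u l.
Proof.
intros Hr Hu.
assert (Hd : forall n p,
  (Cmod (u (n + p)%nat - u n) <= B / (1 - r) * r ^ n * (1 - r ^ p))%R).
{ intros n p; induction p as [|p IH].
  - rewrite Nat.add_0_r; replace (u n - u n) with (RtoC 0) by ring.
    rewrite Cmod_0; simpl; lra.
  - rewrite Nat.add_succ_r.
    replace (u (S (n + p)) - u n)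
      with ((u (S (n + p)) - u (n + p)%nat) + (u (n + p)%nat - u n)) by ring.
    apply Rle_trans with (1 := Cmod_triangle _ _).
    pose proof (Hu (n + p)%nat) as H; rewrite pow_add in H.
    apply Rle_trans with (1 := Rplus_le_compat _ _ _ _ H IH).
    apply Req_le; simpl; field; lra. }
assert (HB : (0 <= B)%R).
{ generalize (Hu O); simpl; pose proof (Cmod_ge_0 (u 1%nat - u O)); lra. }
destruct (ex_series_le (K := C_AbsRing) (V := C_CompleteNormedModule)
  (fun n => u (S n) - u n) (fun n => B * r ^ n)%R Hu) as [s Hs].
{ apply (ex_series_scal (K := R_AbsRing) (V := R_NormedModule) B (fun n => r ^ n)%R), ex_series_geom; rewrite Rabs_pos_eq; lra. }
pose proof (proj1 (filterlim_locally_ball_norm (K := C_AbsRing)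
  (U := C_NormedModule) (F := eventually) _ s) Hs) as Hball.
exists (s + u O), (B / (1 - r))%R; intros n.
apply le_epsilon; intros eps Heps.
destruct (Hball (mkposreal eps Heps)) as [N HN].
specialize (HN (n + N)%nat ltac:(lia)).
assert (E : forall k, sum_n (fun n => u (S n) - u n) k = u (S k) - u O).
{ induction k as [|k IHk].
  - now rewrite sum_O.
  - rewrite sum_Sn, IHk; unfold plus; simpl; ring. }
unfold ball_norm, minus, plus, opp, norm in HN; simpl in HN.
rewrite E in HN.
replace (u n - (s + u O))
  with (- (u (n + S N)%nat - u n) + (u (n + S N)%nat - u O + - s)) by ring.
apply Rle_trans with (1 := Cmod_triangle _ _); rewrite Cmod_opp.
apply Rplus_le_compat.
- apply Rle_trans with (1 := Hd n (S N)).
  rewrite <- (Rmult_1_r (B / (1 - r) * r ^ n)) at 2.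
  apply Rmult_le_compat_l.
  + apply Rmult_le_pos; [apply Rdiv_le_0_compat; lra | apply pow_le; lra].
  + pose proof (pow_lt r (S N)); lra.
- rewrite Nat.add_succ_r; apply Rlt_le; exact HN.
Qed.

Lemma exp_le_compat (a b : R) : (a <= b -> exp a <= exp b)%R.
Proof.
intros [H|H]; [now apply Rlt_le, exp_increasing | subst; apply Rle_refl].
Qed.

(** Both [(x;q)_n] and [1/(q;q)_n] are products with factors
    [1 + O(q^k)]; this is their common bound.  The induction needs the sharper
    exponent [a (1 + r + ... + r^(n-1))]. *)
Lemma geom_product_le_exp (r a : R) (p : nat -> R) :
  (0 < r < 1)%R -> (0 <= a)%R -> p O = 1%R ->
  (forall n, (0 <= p n)%R) ->
  (forall n, (p (S n) <= p n * (1 + a * r ^ n))%R) ->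
  forall n, (p n <= exp (a / (1 - r)))%R.
Proof.
intros Hr Ha H0 Hp HS n.
apply Rle_trans with (exp (a / (1 - r) * (1 - r ^ n))).
- induction n as [|n IH].
  + rewrite H0; simpl; rewrite Rminus_diag, Rmult_0_r, exp_0; lra.
  + apply Rle_trans with (1 := HS n).
    replace (a / (1 - r) * (1 - r ^ S n))%R
      with (a / (1 - r) * (1 - r ^ n) + a * r ^ n)%R by (simpl; field; lra).
    rewrite exp_plus.
    assert (0 <= a * r ^ n)%R by (apply Rmult_le_pos; [|apply pow_le]; lra).
    apply Rmult_le_compat; [apply Hp | lra | exact IH |].
    now apply exp_ineq1_le.
- assert (0 <= a / (1 - r))%R by (apply Rdiv_le_0_compat; lra).
  pose proof (pow_lt r n ltac:(lra)).
  apply exp_le_compat; nra.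
Qed.

Lemma Cmod_real_pow (q : R) (n : nat) : (0 < q < 1)%R ->
  Cmod (RtoC q ^ n) = (q ^ n)%R.
Proof. intros Hq; rewrite Cmod_pow, Cmod_R, Rabs_pos_eq; lra. Qed.

Lemma Cmod_qpoch_le (q : R) (x : C) (n : nat) : (0 < q < 1)%R ->
  (Cmod (qpoch x q n) <= exp (Cmod x / (1 - q)))%R.
Proof.
intros Hq; revert n; apply (geom_product_le_exp q (Cmod x)).
- exact Hq.
- apply Cmod_ge_0.
- apply Cmod_1.
- intros n; apply Cmod_ge_0.
- intros n; simpl; rewrite Cmod_mult.
  apply Rmult_le_compat_l; [apply Cmod_ge_0|].
  unfold Cminus; apply Rle_trans with (1 := Cmod_triangle _ _).
  rewrite Cmod_1, Cmod_opp, Cmod_mult, Cmod_real_pow by exact Hq; lra.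
Qed.

Lemma geom_cvg_qpoch (q : R) (x : C) : (0 < q < 1)%R ->
  geom_cvg q (qpoch x q) (qpoch_inf x q).
Proof.
intros Hq.
destruct (geom_cvg_of_steps q (exp (Cmod x / (1 - q)) * Cmod x) (qpoch x q) Hq)
  as [l Hl].
- intros n; simpl.
  replace (qpoch x q n * (1 - x * q ^ n) - qpoch x q n)
    with (- (qpoch x q n * x * q ^ n)) by ring.
  rewrite Cmod_opp, !Cmod_mult, Cmod_real_pow by exact Hq.
  apply Rmult_le_compat_r; [apply pow_le; lra|].
  apply Rmult_le_compat_r; [apply Cmod_ge_0|].
  now apply Cmod_qpoch_le.
- unfold qpoch_inf.
  now rewrite (Clim_seq_unique _ _ (geom_cvg_filterlim q _ l Hq Hl)).
Qed.

Lemma geom_cvg_Cprod (q : R) (d : nat -> C) (s : list nat) : (0 < q < 1)%R ->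
  geom_cvg q (fun n => qpochs (map d s) q n)
    (Cprod (map (fun j => qpoch_inf (d j) q) s)).
Proof.
intros Hq; induction s as [|j s IH].
- exists 0%R; intros n; unfold qpochs; simpl.
  replace (1 - 1) with (RtoC 0) by ring; rewrite Cmod_0; lra.
- apply (geom_cvg_mult q (qpoch (d j) q)); [exact Hq | | exact IH].
  now apply geom_cvg_qpoch.
Qed.

Lemma one_minus_qpow_neq0 (q : R) (k : nat) : (0 < q < 1)%R ->
  1 - RtoC q * RtoC q ^ k <> 0.
Proof.
intros Hq; rewrite <- Cpow_S, <- RtoC_pow, <- RtoC_minus.
intros E; apply RtoC_inj in E.
assert (q ^ S k < 1)%R by (apply pow_lt_1_compat; [lra|lia]).
lra.
Qed.

(** Since [1/(1 - q^(k+1)) <= 1 + q^(k+1)/(1 - q)], the inverse is again a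
    product of the form [1 + a q^k], with [a = q/(1 - q)]. *)
Lemma Cmod_inv_qpoch_le (q : R) (n : nat) : (0 < q < 1)%R ->
  (Cmod (/ qpoch q q n) <= exp (q / (1 - q) / (1 - q)))%R.
Proof.
intros Hq; revert n; apply (geom_product_le_exp q (q / (1 - q))).
- exact Hq.
- apply Rdiv_le_0_compat; lra.
- simpl; replace (/ 1) with (RtoC 1) by (field; exact C1_nz); apply Cmod_1.
- intros n; apply Cmod_ge_0.
- intros n; simpl.
  pose proof (one_minus_qpow_neq0 q n Hq) as H1.
  assert (H2 : qpoch q q n <> 0)
    by (apply qpoch_qq_neq0; intros k; now apply one_minus_qpow_neq0).
  replace (/ (qpoch q q n * (1 - q * q ^ n)))
    with (/ qpoch q q n * / (1 - q * q ^ n)) by (field; auto).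
  rewrite Cmod_mult.
  apply Rmult_le_compat_l; [apply Cmod_ge_0|].
  rewrite Cmod_inv by exact H1.
  rewrite <- RtoC_pow, <- RtoC_mult, <- RtoC_minus, Cmod_R.
  assert (q ^ n <= 1)%R by (rewrite <- (pow1 n); apply pow_incr; lra).
  pose proof (pow_lt q n ltac:(lra)).
  rewrite Rabs_pos_eq by nra.
  apply Rmult_le_reg_l with (1 - q * q ^ n)%R; [nra|].
  rewrite Rinv_r by nra.
  replace ((1 - q * q ^ n) * (1 + q / (1 - q) * q ^ n))%R
    with (1 + q * q ^ n * (q * (1 - q ^ n) / (1 - q)))%R by (field; lra).
  assert (0 <= q * (1 - q ^ n) / (1 - q))%R
    by (apply Rdiv_le_0_compat; [apply Rmult_le_pos|]; lra).
  assert (0 <= q * q ^ n)%R by nra.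
  pose proof (Rmult_le_pos (q * q ^ n) (q * (1 - q ^ n) / (1 - q))).
  lra.
Qed.

(** * Summation of the weighted partial sums *)

(** The rate [q^(2i)], and not just [q^i], is what beats the error [q^k] in
    [geom_cvg_weighted_sum]; it comes from [2 i <= i (i + 1) / 2 + 1]. *)
Lemma Cmod_euler_coeff_le (q : R) (i : nat) : (0 < q < 1)%R ->
  (Cmod (euler_coeff q i)
   <= exp (q / (1 - q) / (1 - q)) / q * q ^ (2 * i))%R.
Proof.
intros Hq; unfold euler_coeff, Cdiv.
rewrite !Cmod_mult, Cmod_pow, Cmod_m1, pow1, Rmult_1_l.
rewrite !Cmod_real_pow, <- pow_add by exact Hq.
assert (Hi : (q ^ (i * (i - 1) / 2 + i) <= / q * q ^ (2 * i))%R).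
{ assert (Hle : (2 * i <= S (i * (i - 1) / 2 + i))%nat).
  { induction i as [|i IH]; [lia|].
    rewrite half_SnSn; destruct i as [|i]; [cbn; lia | lia]. }
  apply Rmult_le_reg_l with q; [lra|].
  replace (q * (/ q * q ^ (2 * i)))%R with (q ^ (2 * i))%R by (field; lra).
  change (q ^ S (i * (i - 1) / 2 + i) <= q ^ (2 * i))%R.
  replace (S (i * (i - 1) / 2 + i))
    with (2 * i + (S (i * (i - 1) / 2 + i) - 2 * i))%nat by lia.
  rewrite pow_add; apply Rle_trans with (q ^ (2 * i) * 1)%R; [|lra].
  apply Rmult_le_compat_l; [apply pow_le; lra|].
  rewrite <- (pow1 (S (i * (i - 1) / 2 + i) - 2 * i)).
  apply pow_incr; lra. }
pose proof (Cmod_inv_qpoch_le q i Hq) as H.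
apply Rle_trans with (/ q * q ^ (2 * i) * exp (q / (1 - q) / (1 - q)))%R.
- apply Rmult_le_compat; [apply pow_le; lra | apply Cmod_ge_0 | exact Hi | exact H].
- apply Req_le; field; lra.
Qed.

(** The sum is [r^N (1 + r + ... + r^N)]; the induction step is an equality of
    the bounds. *)
Lemma sum_pow_convolution (r : R) (N : nat) : (0 < r < 1)%R ->
  (sum_n (fun k => r ^ (2 * (N - k)) * r ^ k) N <= r ^ N / (1 - r))%R.
Proof.
intros Hr; induction N as [|N IH].
- rewrite sum_O; simpl.
  apply Rmult_le_reg_r with (1 - r)%R; [lra|].
  replace (1 / (1 - r) * (1 - r))%R with 1%R by (field; lra).
  change (1 * 1 * (1 - r) <= 1)%R; lra.
- rewrite sum_Sn, Nat.sub_diag.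
  rewrite (sum_n_ext_loc _ (fun k => r ^ 2 * (r ^ (2 * (N - k)) * r ^ k))%R).
  2:{ intros k Hk; replace (2 * (S N - k))%nat with (2 + 2 * (N - k))%nat by lia.
      now rewrite pow_add, Rmult_assoc. }
  rewrite (sum_n_mult_l (K := R_Ring) (r ^ 2)%R).
  unfold plus, mult; simpl plus; simpl mult.
  apply Rle_trans with (r ^ 2 * (r ^ N / (1 - r)) + 1 * r ^ S N)%R.
  + apply Rplus_le_compat_r, Rmult_le_compat_l; [apply pow_le; lra | exact IH].
  + apply Req_le; simpl; field; lra.
Qed.

(** As the weights add up to [1], the error is the weighted sum of the errors
    [A k * B (N + k) - a * b = O(q^k)], and these are summed with the bound
    [O(q^(2(N-k)))] on the weights. *)
Lemma geom_cvg_weighted_sum (q : R) (A B : nat -> C) (a b : C) :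
  (0 < q < 1)%R -> geom_cvg q A a -> geom_cvg q B b ->
  geom_cvg q
    (fun N => sum_n (fun k =>
       / qpoch q q k * euler_coeff q (N - k) * (A k * B (N + k)%nat)) N)
    (a * b).
Proof.
intros Hq HA HB.
destruct (geom_cvg_bounded q A a Hq HA) as [M HM].
destruct HA as [cA HA]; destruct HB as [cB HB].
set (E := exp (q / (1 - q) / (1 - q))).
(* The bound for [A k * (B (N + k) - b) + (A k - a) * b]. *)
set (c := (M * cB + cA * Cmod b)%R).
assert (HE : (0 < E)%R) by apply exp_pos.
assert (Hterm : forall N k,
  (Cmod (A k * B (N + k)%nat - a * b) <= c * q ^ k)%R).
{ intros N k.
  replace (A k * B (N + k)%nat - a * b)
    with (A k * (B (N + k)%nat - b) + (A k - a) * b) by ring.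
  apply Rle_trans with (1 := Cmod_triangle _ _); rewrite !Cmod_mult.
  assert (HcB : (0 <= cB)%R).
  { generalize (HB O); simpl; pose proof (Cmod_ge_0 (B O - b)); lra. }
  assert (H1 : (Cmod (B (N + k)%nat - b) <= cB * q ^ k)%R).
  { apply Rle_trans with (1 := HB _), Rmult_le_compat_l; [exact HcB|].
    rewrite pow_add; apply Rle_trans with (1 * q ^ k)%R; [|lra].
    apply Rmult_le_compat_r; [apply pow_le; lra|].
    rewrite <- (pow1 N); apply pow_incr; lra. }
  pose proof (Rmult_le_compat _ _ _ _ (Cmod_ge_0 _) (Cmod_ge_0 _) (HM k) H1).
  pose proof (Rmult_le_compat_r _ _ _ (Cmod_ge_0 b) (HA k)).
  unfold c; lra. }
assert (Hc : (0 <= c)%R).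
{ pose proof (Rle_trans _ _ _ (Cmod_ge_0 _) (Hterm O O)) as H.
  simpl in H; lra. }
exists (E * (E / q) * c / (1 - q))%R; intros N.
assert (Hdiff : sum_n (fun k =>
      / qpoch q q k * euler_coeff q (N - k) * (A k * B (N + k)%nat)) N - a * b
  = sum_n (fun k =>
      / qpoch q q k * euler_coeff q (N - k) * (A k * B (N + k)%nat - a * b)) N).
{ rewrite (sum_n_ext (fun k => _ * (_ - a * b)) (fun k =>
      / qpoch q q k * euler_coeff q (N - k) * (A k * B (N + k)%nat)
      + - (a * b) * (/ qpoch q q k * euler_coeff q (N - k)))).
  2:{ intros k; Ceq; ring. }
  rewrite Csum_plus, Csum_scal, sum_euler_weights.
  - Ceq; ring.
  - intros k; now apply one_minus_qpow_neq0. }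
rewrite Hdiff.
apply Rle_trans with
  (sum_n (fun k => E * (E / q) * c * (q ^ (2 * (N - k)) * q ^ k))%R N).
- apply Csum_Cmod_le; intros k Hk; rewrite !Cmod_mult.
  pose proof (Cmod_inv_qpoch_le q k Hq) as H1.
  pose proof (Cmod_euler_coeff_le q (N - k) Hq) as H2.
  fold E in H1, H2.
  replace (E * (E / q) * c * (q ^ (2 * (N - k)) * q ^ k))%R
    with (E * (E / q * q ^ (2 * (N - k))) * (c * q ^ k))%R by ring.
  apply Rmult_le_compat; [|apply Cmod_ge_0| |apply Hterm].
  + apply Rmult_le_pos; apply Cmod_ge_0.
  + apply Rmult_le_compat; try apply Cmod_ge_0; assumption.
- rewrite (sum_n_mult_l (K := R_Ring) (E * (E / q) * c)%R).
  unfold mult; simpl mult.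
  replace (E * (E / q) * c / (1 - q) * q ^ N)%R
    with (E * (E / q) * c * (q ^ N / (1 - q)))%R by (field; lra).
  apply Rmult_le_compat_l; [|now apply sum_pow_convolution].
  repeat apply Rmult_le_pos; try lra.
  apply Rlt_le, Rinv_0_lt_compat; lra.
Qed.

Lemma qpochs_lower_zeros (q : C) (m k : nat) :
  qpochs (q :: repeat (RtoC 0) m) q k = qpoch q q k.
Proof.
assert (H0 : qpoch 0 q k = 1).
{ induction k as [|k IH]; simpl; [reflexivity | rewrite IH; ring]. }
unfold qpochs; simpl.
replace (Cprod _) with (RtoC 1); [ring|].
induction m as [|m IH]; simpl; [reflexivity|].
rewrite <- IH, H0; ring.
Qed.

Theorem theorem1p6 (q : R) (m : nat) (alpha : C) (c : nat -> C)
  (hq : (0 < q < 1)%R) :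
  is_series
    (fun n : nat =>
       vwp alpha q n * (- (1)) ^ n * RtoC q ^ (n * (n - 1) / 2) / qpoch q q n
       * phi ([/ RtoC q ^ n; alpha * RtoC q ^ n]
                ++ map (fun j => alpha * c j) (seq 1 m))
             (repeat (RtoC 0) (m + 1)) q q)
    (qpoch_inf (alpha * q) q
     * Cprod (map (fun j => qpoch_inf (alpha * c j) q) (seq 1 m))).
Proof.
assert (Hq0 : RtoC q <> 0) by (intros E; apply RtoC_inj in E; lra).
pose proof (fun k => one_minus_qpow_neq0 q k hq) as Hq1.
set (A := fun k => qpochs (map (fun j => alpha * c j) (seq 1 m)) q k).
rewrite Cmult_comm.
apply filterlim_ext with (fun N => sum_n (fun k =>
  / qpoch q q k * euler_coeff q (N - k)
  * (A k * qpoch (alpha * q) q (N + k)%nat)) N).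
- intros N.
  transitivity (sum_n (fun k => partial_coeff alpha q N k * A k) N).
  { apply sum_n_ext; intros k; unfold partial_coeff; Ceq; ring. }
  rewrite <- partial_sum_bailey by assumption.
  apply sum_n_ext; intros n.
  rewrite (phi_terminating _ _ _ _ n) by (simpl; auto).
  rewrite <- Csum_scal.
  apply sum_n_ext; intros k; unfold bailey_coeff, phi_term.
  rewrite qpochs_lower_zeros.
  change (qpochs _ q k) with (qpoch (/ RtoC q ^ n) q k
    * (qpoch (alpha * RtoC q ^ n) q k * A k)).
  unfold Cdiv; Ceq; ring.
- apply (geom_cvg_filterlim q); [exact hq|].
  apply geom_cvg_weighted_sum; [exact hq | |].
  + exact (geom_cvg_Cprod q (fun j => alpha * c j) (seq 1 m) hq).
  + now apply geom_cvg_qpoch.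
Qed.
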